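(* Let $\frac{d\bm{x}}{dt}=\bm{F}(\bm{x},t)$ be a (possibly non-autonomous) dynamical system, with $\bm{F}:\mathbb{R}^N\times\mathbb{R}\to\mathbb{R}^N$ continuously differentiable in $\bm{x}$, and let $\mathcal{K}$ and $\mathcal{P}$ be its Koopman and Perron--Frobenius generators. Let $U\subseteq\mathbb{R}^N$ be open and let $u_1,u_2:U\to\mathbb{C}$ be continuously differentiable, nowhere vanishing functions satisfying $$\frac{\mathcal{P}u_1(\bm{x})}{u_1(\bm{x})}=\frac{\mathcal{P}u_2(\bm{x})}{u_2(\bm{x})}\qquad\text{for all }\bm{x}\in U\text{ and all }t.$$ Then the ratio $u_2/u_1$ is a Koopman eigenfunction of $\mathcal{K}$ with eigenvalue $0$, i.e. $\mathcal{K}\left(u_2/u_1\right)=0$ on $U$ for all $t$, and thus $u_2/u_1$ is an invariant of the system.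
   Context: For $\frac{d\bm{x}}{dt}=\bm{F}(\bm{x},t)$, the Koopman generator acts on a continuously differentiable function $u$ by $(\mathcal{K}u)(\bm{x})=\bm{F}(\bm{x},t)\cdot\nabla u(\bm{x})$, and the Perron--Frobenius (Liouville) generator acts by $(\mathcal{P}v)(\bm{x})=-\nabla\cdot(\bm{F}(\bm{x},t)v(\bm{x}))$. Both operators generally depend on $t$. A Koopman eigenfunction with eigenvalue $\lambda\in\mathbb{C}$ is a function $u$, not identically zero, with $\mathcal{K}u=\lambda u$ (for all $t$). An invariant (constant of motion) is a function $w$ that is constant along trajectories: $w(\bm{x}(t))$ does not depend on $t$ for every solution $\bm{x}(t)$ of the system lying in the domain of $w$. *)

(* Defs.v *)
(* The real line is an arbitrary R : realType and the complex plane is R[i]. *)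
From mathcomp Require Export all_boot all_order all_algebra.
From mathcomp Require Export complex.
From mathcomp Require Export all_classical all_reals topology normedtype derive.
Export numFieldNormedType.Exports.
Import GRing.Theory Num.Theory.

Set Implicit Arguments.
Unset Strict Implicit.
Unset Printing Implicit Defensive.

Global Open Scope classical_set_scope.
Global Open Scope ring_scope.

Section Generators.
Context {R : realType} {N : nat}.
Local Notation state := 'rV[R]_N.

(* For open U, whether f satisfies this, and the derivatives at points of U,
   depend only on the restriction of f to U: a function defined on U is encoded
   by any total function extending it.  Since the dimension is finite,
   continuity of every 'D_v f is continuity of the differential. *)
Definition C1_on (V : normedModType R) (U : set state) (f : state -> V) : Prop :=
  forall x, U x ->
    differentiable f x /\ forall v, {for x, continuous (fun y => 'D_v f y)}.

(* R[i] carries no normed module structure over R in the library, so the real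
   differential calculus of complex-valued functions is done componentwise. *)
Definition C1_on_complex (U : set state) (u : state -> R[i]) : Prop :=
  C1_on U (fun x => complex.Re (u x)) /\ C1_on U (fun x => complex.Im (u x)).

Definition cpartial (i : 'I_N) (u : state -> R[i]) (x : state) : R[i] :=
  let e := delta_mx 0 i in
  Complex ('D_e (fun y => complex.Re (u y)) x)
          ('D_e (fun y => complex.Im (u y)) x).

Definition koopman (F : state -> R -> state) (t : R) (u : state -> R[i])
    (x : state) : R[i] :=
  \sum_(i < N) (F x t 0 i)%:C%C * cpartial i u x.

Definition perron_frobenius (F : state -> R -> state) (t : R)
    (v : state -> R[i]) (x : state) : R[i] :=
  - \sum_(i < N) cpartial i (fun y => (F y t 0 i)%:C%C * v y) x.

Definition koopman_eigenfunction (F : state -> R -> state) (U : set state)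
    (u : state -> R[i]) (lambda : R[i]) : Prop :=
  [/\ C1_on_complex U u,
      exists2 x, U x & u x != 0 &
      forall t x, U x -> koopman F t u x = lambda * u x].

(* I may be open, closed, half-open, bounded or not; endpoints belonging to I
   only require continuity. *)
Definition is_solution (F : state -> R -> state) (I : set R) (x : R -> state)
    : Prop :=
  [/\ is_interval I,
      {within I, continuous x} &
      forall t, I° t -> is_derive t 1 x (F (x t) t)].

Definition is_invariant (F : state -> R -> state) (U : set state)
    (w : state -> R[i]) : Prop :=
  forall (I : set R) (x : R -> state), is_solution F I x ->
    (forall t, I t -> U (x t)) ->
    forall s t, I s -> I t -> w (x s) = w (x t).

End Generators.

(* Main.v *)
(* On U we have u2 = w u1 with w = u2/u1, and the Leibniz rule gives
   P(w u1) = w P u1 - (K w) u1.  Dividing by u2, the hypothesis says exactly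
   (K w) u1 / u2 = 0, so K w = 0.  Along a trajectory, K w is the derivative of w
   by the chain rule, so the mean value theorem makes w constant. *)
Require Import Defs.
From mathcomp Require Import ring.
Import Order.TTheory GRing.Theory Num.Theory.

Set Implicit Arguments.
Unset Strict Implicit.
Unset Printing Implicit Defensive.

(** * Real $C^1$ functions on an open set: sums, products, inverses *)

Section C1.
Context {R : realType} {N : nat} {U : set 'rV[R]_N}.
Hypothesis openU : open U.
Implicit Types f g : 'rV[R]_N -> R.

Lemma C1_on_continuous f x : C1_on U f -> U x -> {for x, continuous f}.
Proof. by move=> Cf /Cf[/differentiable_continuous]. Qed.

Lemma C1_on_derivable f x v : C1_on U f -> U x -> derivable f x v.
Proof. by move=> Cf /Cf[df _]; exact: diff_derivable. Qed.

(** Continuity at [x] depends only on values near [x]. The differentiation rules below hold only at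
    points of [U], so openness of [U] carries the continuity of their right-hand sides over to the
    derivative itself. *)
Lemma eq_on_open_continuous (h k : 'rV[R]_N -> R) x :
  U x -> (forall y, U y -> h y = k y) ->
  {for x, continuous k} -> {for x, continuous h}.
Proof.
move=> Ux hk ck; rewrite /prop_for /continuous_at hk//.
have kh : \forall y \near x, k y = h y.
  by apply: filterS (open_nbhs_nbhs (conj openU Ux)) => y /hk.
exact: cvg_trans (near_eq_cvg kh) ck.
Qed.

Lemma C1_onD f g : C1_on U f -> C1_on U g -> C1_on U (fun x => f x + g x).
Proof.
move=> Cf Cg x Ux; have [df cf] := Cf x Ux; have [dg cg] := Cg x Ux.
split=> [|v]; first exact: differentiableD.
apply: (@eq_on_open_continuous _ (fun y => 'D_v f y + 'D_v g y)) => //.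
  by move=> y Uy; rewrite -deriveD//; exact: C1_on_derivable.
exact: continuousD.
Qed.

Lemma C1_onN f : C1_on U f -> C1_on U (fun x => - f x).
Proof.
move=> Cf x Ux; have [df cf] := Cf x Ux.
split=> [|v]; first exact: differentiableN.
apply: (@eq_on_open_continuous _ (fun y => - 'D_v f y)) => //.
  by move=> y Uy; rewrite -deriveN//; exact: C1_on_derivable.
exact: continuousN.
Qed.

Lemma C1_onM f g : C1_on U f -> C1_on U g -> C1_on U (fun x => f x * g x).
Proof.
move=> Cf Cg x Ux; have [df cf] := Cf x Ux; have [dg cg] := Cg x Ux.
split=> [|v]; first exact: differentiableM.
apply: (@eq_on_open_continuous _ (fun y => f y * 'D_v g y + g y * 'D_v f y)) => //.
  by move=> y Uy; rewrite (deriveM (C1_on_derivable Cf Uy) (C1_on_derivable Cg Uy)).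
by apply: continuousD; apply: continuousM => //; exact: C1_on_continuous.
Qed.

Lemma C1_onV f : (forall x, U x -> f x != 0) -> C1_on U f ->
  C1_on U (fun x => (f x)^-1).
Proof.
move=> f0 Cf x Ux; have [df cf] := Cf x Ux.
split=> [|v]; first by apply: differentiableV => //; exact: f0.
apply: (@eq_on_open_continuous _ (fun y => - ((f y)^-1 * (f y)^-1) * 'D_v f y)) => //.
  move=> y Uy; rewrite (deriveV (f0 _ Uy) (C1_on_derivable Cf Uy)).
  by rewrite expr2 invfM.
have cV : {for x, continuous (fun y => (f y)^-1)}.
  by apply: continuousV; [exact: f0|exact: C1_on_continuous].
exact: (continuousM (continuousN (continuousM cV cV)) (cf v)).
Qed.

End C1.

(** * Complex-valued functions through their real and imaginary parts *)

Section C1_complex.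
Context {R : realType} {N : nat} {U : set 'rV[R]_N}.
Hypothesis openU : open U.
Implicit Types u v : 'rV[R]_N -> R[i].

Lemma ReM (z w : R[i]) :
  complex.Re (z * w) = complex.Re z * complex.Re w - complex.Im z * complex.Im w.
Proof. by case: z w => [a b] [c d]. Qed.

Lemma ImM (z w : R[i]) :
  complex.Im (z * w) = complex.Re z * complex.Im w + complex.Im z * complex.Re w.
Proof. by case: z w => [a b] [c d]. Qed.

(** From $1/z = \bar z/|z|^2$. The squares are spelled as products so that [C1_onM] applies to
    them. *)
Lemma ReV (z : R[i]) : complex.Re z^-1 =
  complex.Re z * (complex.Re z * complex.Re z + complex.Im z * complex.Im z)^-1.
Proof. by case: z => [a b]; rewrite -!expr2. Qed.

Lemma ImV (z : R[i]) : complex.Im z^-1 =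
  - (complex.Im z * (complex.Re z * complex.Re z + complex.Im z * complex.Im z)^-1).
Proof. by case: z => [a b]; rewrite -!expr2. Qed.

Lemma C1_on_complexM u v : C1_on_complex U u -> C1_on_complex U v ->
  C1_on_complex U (fun x => u x * v x).
Proof.
move=> [ru iu] [rv iv]; split.
  rewrite (funext (fun x => ReM (u x) (v x))).
  exact (C1_onD openU (C1_onM openU ru rv) (C1_onN openU (C1_onM openU iu iv))).
rewrite (funext (fun x => ImM (u x) (v x))).
exact (C1_onD openU (C1_onM openU ru iv) (C1_onM openU iu rv)).
Qed.

Lemma C1_on_complexV u : (forall x, U x -> u x != 0) -> C1_on_complex U u ->
  C1_on_complex U (fun x => (u x)^-1).
Proof.
move=> u0 [ru iu].
(* $|u|^2$ is a sum of two real squares, so it vanishes only where both components of [u] do. *)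
have n0 x : U x -> complex.Re (u x) * complex.Re (u x) +
    complex.Im (u x) * complex.Im (u x) != 0.
  move=> /u0; rewrite -!expr2 paddr_eq0 ?sqr_ge0// !sqrf_eq0.
  by case: (u x) => a b; rewrite eq_complex.
have Cn := C1_onV openU n0 (C1_onD openU (C1_onM openU ru ru) (C1_onM openU iu iu)).
split.
  by rewrite (funext (fun x => ReV (u x))); exact (C1_onM openU ru Cn).
by rewrite (funext (fun x => ImV (u x))); exact (C1_onN openU (C1_onM openU iu Cn)).
Qed.

Lemma cpartialM i u v x :
  differentiable (fun y => complex.Re (u y)) x ->
  differentiable (fun y => complex.Im (u y)) x ->
  differentiable (fun y => complex.Re (v y)) x ->
  differentiable (fun y => complex.Im (v y)) x ->
  cpartial i (fun y => u y * v y) x = cpartial i u x * v x + u x * cpartial i v x.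
Proof.
move=> dru diu drv div; rewrite /cpartial.
set e := delta_mx 0 i.
have Dru : derivable _ x e := diff_derivable dru.
have Diu : derivable _ x e := diff_derivable diu.
have Drv : derivable _ x e := diff_derivable drv.
have Div : derivable _ x e := diff_derivable div.
have -> : (fun y => complex.Re (u y * v y)) =
    (fun y => complex.Re (u y)) * (fun y => complex.Re (v y)) -
    (fun y => complex.Im (u y)) * (fun y => complex.Im (v y)).
  by apply/funext => y; rewrite ReM.
have -> : (fun y => complex.Im (u y * v y)) =
    (fun y => complex.Re (u y)) * (fun y => complex.Im (v y)) +
    (fun y => complex.Im (u y)) * (fun y => complex.Re (v y)).
  by apply/funext => y; rewrite ImM.
rewrite (deriveB (derivableM Dru Drv) (derivableM Diu Div)).
rewrite (deriveD (derivableM Dru Div) (derivableM Diu Drv)).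
rewrite (deriveM Dru Drv) (deriveM Diu Div) (deriveM Dru Div) (deriveM Diu Drv).
apply/eqP; rewrite eq_complex ?raddfD/= !ReM !ImM/=.
(* With the four real derivatives turned into variables, each component is a polynomial identity. *)
move: ('D_e (fun y => complex.Re (u y)) x) ('D_e (fun y => complex.Im (u y)) x).
move: ('D_e (fun y => complex.Re (v y)) x) ('D_e (fun y => complex.Im (v y)) x).
by move=> a b c d; apply/andP; split; apply/eqP; rewrite /GRing.scale/=; ring.
Qed.

(** Needed because $u_2 = (u_2/u_1)\,u_1$ is guaranteed only on [U]: elsewhere [u1] may vanish. *)
Lemma near_eq_cpartial i u v x : (\near x, u x = v x) ->
  cpartial i u x = cpartial i v x.
Proof.
move=> uv; rewrite /cpartial; congr Complex; apply: near_eq_derive.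
  by apply: filterS uv => y ->.
by apply: filterS uv => y ->.
Qed.

End C1_complex.

(** * The two generators and the trajectories *)

Lemma ReD {R : realType} (z w : R[i]) :
  complex.Re (z + w) = complex.Re z + complex.Re w.
Proof. by case: z w => [a b] [c d]. Qed.

Lemma ImD {R : realType} (z w : R[i]) :
  complex.Im (z + w) = complex.Im z + complex.Im w.
Proof. by case: z w => [a b] [c d]. Qed.

(** The differential is linear, so it can be expanded along the standard basis. *)
Lemma derive_sum_partial {R : realType} {N : nat} (g : 'rV[R]_N -> R) x v :
  differentiable g x -> 'D_v g x = \sum_(i < N) v 0 i * 'D_(delta_mx 0 i) g x.
Proof.
move=> dg; rewrite deriveE// {1}(row_sum_delta v) linear_sum.
by apply: eq_bigr => i _; rewrite linearZ deriveE.
Qed.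

Section Flow.
Context {R : realType} {N : nat}.
Variable F : 'rV[R]_N -> R -> 'rV[R]_N.

(** Since [F] is real, the generator acts on each component separately, as the derivative along
    [F x t]. *)
Lemma Re_koopman t (w : 'rV[R]_N -> R[i]) x :
  differentiable (fun y => complex.Re (w y)) x ->
  complex.Re (koopman F t w x) = 'D_(F x t) (fun y => complex.Re (w y)) x.
Proof.
move=> dw; rewrite derive_sum_partial// (big_morph _ ReD (erefl _)).
by apply: eq_bigr => i _; rewrite ReM /= mul0r subr0.
Qed.

Lemma Im_koopman t (w : 'rV[R]_N -> R[i]) x :
  differentiable (fun y => complex.Im (w y)) x ->
  complex.Im (koopman F t w x) = 'D_(F x t) (fun y => complex.Im (w y)) x.
Proof.
move=> dw; rewrite derive_sum_partial// (big_morph _ ImD (erefl _)).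
by apply: eq_bigr => i _; rewrite ImM /= mul0r addr0.
Qed.

(** Each $F_i (w v)$ is regrouped as $w (F_i v)$ and differentiated as a product of two factors, so
    the divergence of [F] never has to be expanded. *)
Lemma perron_frobeniusM t (w v : 'rV[R]_N -> R[i]) x :
  differentiable (fun y => F y t) x ->
  differentiable (fun y => complex.Re (w y)) x ->
  differentiable (fun y => complex.Im (w y)) x ->
  differentiable (fun y => complex.Re (v y)) x ->
  differentiable (fun y => complex.Im (v y)) x ->
  perron_frobenius F t (fun y => w y * v y) x =
  w x * perron_frobenius F t v x - koopman F t w x * v x.
Proof.
move=> dF drw diw drv div; rewrite /perron_frobenius /koopman.
rewrite mulrN mulr_sumr mulr_suml -opprD -big_split/=; congr (- _).
apply: eq_bigr => i _.
have dFi : differentiable (fun y => F y t 0 i) x.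
  exact: (differentiable_comp dF (differentiable_coord _ _ _)).
have dReFv : differentiable (fun y => complex.Re ((F y t 0 i)%:C%C * v y)) x.
  rewrite (_ : (fun y => _) = (fun y => F y t 0 i * complex.Re (v y))).
    exact: differentiableM.
  by apply/funext => y; rewrite ReM /= mul0r subr0.
have dImFv : differentiable (fun y => complex.Im ((F y t 0 i)%:C%C * v y)) x.
  rewrite (_ : (fun y => _) = (fun y => F y t 0 i * complex.Im (v y))).
    exact: differentiableM.
  by apply/funext => y; rewrite ImM /= mul0r addr0.
rewrite (funext (fun y => mulrCA (F y t 0 i)%:C%C (w y) (v y))).
by rewrite (cpartialM i drw diw dReFv dImFv) addrC mulrCA mulrA.
Qed.

(** By the chain rule $g \circ x$ has derivative $D_{F(x(t),t)}\,g = 0$, and the mean value theorem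
    applies between any two times. *)
Lemma solution_constant (U : set 'rV[R]_N) (g : 'rV[R]_N -> R) I x :
  (forall y, U y -> differentiable g y) ->
  (forall t y, U y -> 'D_(F y t) g y = 0) ->
  is_solution F I x -> (forall t, I t -> U (x t)) ->
  forall s t, I s -> I t -> g (x s) = g (x t).
Proof.
move=> dg Dg0 [itvI cx dx] xU.
suff lt_const s t : I s -> I t -> s < t -> g (x s) = g (x t).
  by move=> s t Is It; case: (ltgtP s t) => [||->//] st; [|symmetry]; exact: lt_const.
move=> Is It st.
have stI : `[s, t]%classic `<=` I.
  by move=> r /=; rewrite in_itv/=; exact: itvI.
(* The equation of motion is available only in the interior of [I]. The mean value theorem asks for
   no more: at [s] and [t] continuity is enough. *)
have stIo : `]s, t[%classic `<=` I°.
  rewrite -open_subsetE; last exact: interval_open.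
  by apply: subset_trans stI; exact: subset_itv_oo_cc.
have [||c _] := @MVT R (g \o x) (cst 0) s t st.
- move=> r rst; have Ir := stIo _ rst.
  have [xr1 Dx] := dx r Ir; have xr := (derivable1_diffP _ _).1 xr1.
  have Uxr := xU _ (interior_subset Ir); have dgr := dg _ Uxr.
  have dgx := differentiable_comp xr dgr.
  apply: DeriveDef; first exact: diff_derivable.
  (* The chain rule is stated for differentials, hence the passage from directional derivatives and
     back. *)
  rewrite deriveE// diff_comp//= -(deriveE _ xr) Dx -deriveE//.
  exact: Dg0.
- apply: continuous_subspaceW stI _; apply/subspace_continuousP => r Ir.
  have xr := (subspace_continuousP _ _).1 cx r Ir.
  exact: cvg_comp xr (differentiable_continuous (dg _ (xU _ Ir))).
- by rewrite mul0r => /eqP; rewrite subr_eq0 => /eqP.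
Qed.

End Flow.

Theorem theorem1 (R : realType) (N : nat)
  (F : 'rV[R]_N -> R -> 'rV[R]_N)
  (hF : forall t : R, C1_on setT (fun x => F x t))
  (U : set 'rV[R]_N) (hU : open U)
  (u1 u2 : 'rV[R]_N -> R[i])
  (hu1 : C1_on_complex U u1) (hu2 : C1_on_complex U u2)
  (hu1_neq0 : forall x, U x -> u1 x != 0)
  (hu2_neq0 : forall x, U x -> u2 x != 0)
  (hP : forall (t : R) (x : 'rV[R]_N), U x ->
     perron_frobenius F t u1 x / u1 x = perron_frobenius F t u2 x / u2 x) :
  [/\ (U !=set0 -> koopman_eigenfunction F U (fun x => u2 x / u1 x) 0),
      (forall (t : R) (x : 'rV[R]_N), U x ->
         koopman F t (fun y => u2 y / u1 y) x = 0) &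
      is_invariant F U (fun x => u2 x / u1 x)].
Proof.
set w := fun x => u2 x / u1 x.
have Cw : C1_on_complex U w.
  exact (C1_on_complexM hU hu2 (C1_on_complexV hU hu1_neq0 hu1)).
have dReW y (Uy : U y) : differentiable (fun x => complex.Re (w x)) y.
  by have [] := Cw.1 y Uy.
have dImW y (Uy : U y) : differentiable (fun x => complex.Im (w x)) y.
  by have [] := Cw.2 y Uy.
have K0 t x : U x -> koopman F t w x = 0.
  move=> Ux; have u1x := hu1_neq0 x Ux; have u2x := hu2_neq0 x Ux.
  have Pu2 : perron_frobenius F t u2 x =
      w x * perron_frobenius F t u1 x - koopman F t w x * u1 x.
    rewrite -perron_frobeniusM; last 5 first.
    - by have [] := hF t x I.
    - exact: dReW.
    - exact: dImW.
    - by have [] := hu1.1 x Ux.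
    - by have [] := hu1.2 x Ux.
    (* It remains to replace [u2] by the product of [w] and [u1], which agrees with it on the
       neighbourhood [U] of [x]. *)
    congr (- _); apply: eq_bigr => i _; apply: near_eq_cpartial.
    apply: filterS (open_nbhs_nbhs (conj hU Ux)) => y Uy.
    by rewrite /w divfK// hu1_neq0.
  have := hP t x Ux; rewrite Pu2 mulrBl {1}/w.
  have -> : u2 x / u1 x * perron_frobenius F t u1 x / u2 x =
      perron_frobenius F t u1 x / u1 x by field; apply/andP.
  (* The common term cancels, leaving $(\mathcal{K}w)\,u_1/u_2 = 0$, where [u1 x] and [u2 x] are
     nonzero. *)
  move/eqP; rewrite -subr_eq0 subKr !mulf_eq0 invr_eq0.
  by rewrite (negPf u1x) (negPf u2x) !orbF => /eqP.
split => //.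
(* Any point of [U] witnesses that the eigenfunction is not identically zero, as [u2] vanishes
   nowhere on [U]. *)
- case=> x Ux; split=> //; last by move=> t y Uy; rewrite mul0r K0.
  by exists x => //; rewrite /w mulf_neq0 ?invr_neq0 ?hu1_neq0 ?hu2_neq0.
- move=> I x sol xU s t Is It.
  (* The mean value theorem is real, so constancy is shown for each component of [w]. *)
  apply/eqP; rewrite eq_complex; apply/andP; split; apply/eqP.
    apply: (solution_constant (g := fun y => complex.Re (w y)) dReW _ sol xU) => // r y Uy.
    by rewrite -Re_koopman ?K0//; exact: dReW.
  apply: (solution_constant (g := fun y => complex.Im (w y)) dImW _ sol xU) => // r y Uy.
  by rewrite -Im_koopman ?K0//; exact: dImW.
Qed.
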